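(* Let $w^\dagger:\mathcal S\to\mathcal A$ be a policy and let $\mathcal S'=\{1,\dots,S'\}\subset\mathcal S=\{1,\dots,S\}$ be the set of states at which the adversary can falsify the cost. Let $$H=[\bar M_{a_1}^T\ \bar M_{a_2}^T\ \cdots\ \bar M_{a_A}^T]^T\in\mathbb{R}^{(A-1)(S-S')\times S'},$$ with $\bar M_a$ as defined in the context. Suppose there exists $x\in\mathbb{R}^{S'}$ such that $Hx<0$ (componentwise), i.e. the column space of $H$ intersects the negative orthant of $\mathbb{R}^{(A-1)(S-S')}$. Then for any true cost matrix $c\in\mathbb{R}^{S\times A}$, the adversary can find $\tilde c^{fal}_a\in\mathbb{R}^{S'}$, $a\in\mathcal A$, such that $$\begin{bmatrix}\tilde c^{fal}_a\\ c^{true}_a\end{bmatrix}\ \ge\ \begin{bmatrix}R_a&Y_a\\ M_a&N_a\end{bmatrix}\begin{bmatrix}\tilde c^{fal}_{w^\dagger}\\ c^{true}_{w^\dagger}\end{bmatrix}\qquad\text{for all } a\in\mathcal A,$$ where the inequality is componentwise, with equality only in the components $i$ for which $w^\dagger(i)=a$ (strict inequality in all components $i$ with $w^\dagger(i)\neq a$).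
   Context: Finite Markov decision process: $\mathcal S=\{1,\dots,S\}$ is a finite state space, $\mathcal A=\{a_1,\dots,a_A\}$ a finite action space, $p(i,j,a)$ is the probability of moving from state $i$ to state $j$ under action $a$ (so $p(i,j,a)\ge 0$, $\sum_j p(i,j,a)=1$), and $\beta\in(0,1)$ is the discount factor. $P_a\in\mathbb{R}^{S\times S}$ has entries $[P_a]_{i,j}=p(i,j,a)$, and $P_{w^\dagger}\in\mathbb{R}^{S\times S}$ has entries $[P_{w^\dagger}]_{i,j}=p(i,j,w^\dagger(i))$. For each $a\in\mathcal A$, partition $$(I-\beta P_a)(I-\beta P_{w^\dagger})^{-1}=\begin{bmatrix}R_a&Y_a\\ M_a&N_a\end{bmatrix},$$ with $R_a\in\mathbb{R}^{S'\times S'}$, $Y_a\in\mathbb{R}^{S'\times(S-S')}$, $M_a\in\mathbb{R}^{(S-S')\times S'}$, $N_a\in\mathbb{R}^{(S-S')\times(S-S')}$. The rows of $M_a$ are indexed by the states $i\in\mathcal S\setminus\mathcal S'$; $\bar M_a$ is the matrix obtained from $M_a$ by removing the rows corresponding to those states $i\in\mathcal S\setminus\mathcal S'$ with $w^\dagger(i)=a$. The falsified cost matrix $\tilde c\in\mathbb{R}^{S\times A}$ satisfies $\tilde c(i,a)=c(i,a)$ for all $i\in\mathcal S\setminus\mathcal S'$, $a\in\mathcal A$, while its entries $\tilde c(i,a)$, $i\in\mathcal S'$, $a\in\mathcal A$, are chosen freely by the adversary. Notation: $\tilde c^{fal}_a=(\tilde c(i,a))_{i\in\mathcal S'}\in\mathbb{R}^{S'}$,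 $c^{true}_a=(c(i,a))_{i\in\mathcal S\setminus\mathcal S'}\in\mathbb{R}^{S-S'}$, $\tilde c^{fal}_{w^\dagger}=(\tilde c(i,w^\dagger(i)))_{i\in\mathcal S'}$, $c^{true}_{w^\dagger}=(c(i,w^\dagger(i)))_{i\in\mathcal S\setminus\mathcal S'}$. In particular the $i$th component of $\tilde c^{fal}_{w^\dagger}$ is the $i$th component of $\tilde c^{fal}_{w^\dagger(i)}$, for $i\in\mathcal S'$. *)

(* Defs.v *)
From mathcomp Require Import all_boot all_order all_algebra.

Set Implicit Arguments.
Unset Strict Implicit.
Unset Printing Implicit Defensive.

Import Order.TTheory GRing.Theory Num.Theory.
Local Open Scope ring_scope.

(** The state space is ['I_(s + t)] with [s = S'] and [t = S - S']: the states
    of [S'] are the [lshift t i] for [i : 'I_s], those outside [S'] are the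
    [rshift s i] for [i : 'I_t].  Actions are ['I_A]. *)

Section FalsifiedCosts.

Variables (F : realFieldType) (s t A : nat).
Variables (p : 'I_(s + t) -> 'I_(s + t) -> 'I_A -> F) (beta : F).
Variable w : 'I_(s + t) -> 'I_A.

Definition action_mx (a : 'I_A) : 'M[F]_(s + t) := \matrix_(i, j) p i j a.

Definition policy_mx : 'M[F]_(s + t) := \matrix_(i, j) p i j (w i).

(** [invmx B] is the inverse of [B] only when [B] is invertible; this is the
    case here as soon as [p] is stochastic and [0 < beta < 1]. *)
Definition value_mx (a : 'I_A) : 'M[F]_(s + t) :=
  (1%:M - beta *: action_mx a) *m invmx (1%:M - beta *: policy_mx).

Definition R_mx (a : 'I_A) : 'M[F]_(s, s) := ulsubmx (value_mx a).
Definition Y_mx (a : 'I_A) : 'M[F]_(s, t) := ursubmx (value_mx a).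
Definition M_mx (a : 'I_A) : 'M[F]_(t, s) := dlsubmx (value_mx a).
Definition N_mx (a : 'I_A) : 'M[F]_(t, t) := drsubmx (value_mx a).

Definition kept_rows (a : 'I_A) : {set 'I_t} :=
  [set i | w (rshift s i) != a].

(** [enum_val] lists the elements of a set of ordinals in increasing order. *)
Definition Mbar_mx (a : 'I_A) : 'M[F]_(#|kept_rows a|, s) :=
  rowsub enum_val (M_mx a).

Lemma sum_kept_rows : (\sum_(a < A) #|kept_rows a| = A.-1 * t)%N.
Proof.
transitivity (\sum_(a < A) \sum_(i < t) (w (rshift s i) != a))%N.
  apply: eq_bigr => a _; rewrite -sum1_card big_mkcond /=.
  by apply: eq_bigr => i _; rewrite inE; case: (_ != _).
rewrite exchange_big /= (eq_bigr (fun=> A.-1)) => [|i _].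
  by rewrite sum_nat_const card_ord mulnC.
rewrite (eq_bigr (fun a => if a != w (rshift s i) then 1 else 0))%N => [|a _].
  by rewrite -big_mkcond /= sum1_card cardC1 card_ord.
by rewrite eq_sym; case: (_ != _).
Qed.

Definition H_mx : 'M[F]_(A.-1 * t, s) :=
  castmx (sum_kept_rows, erefl s) (\mxcol_(a < A) Mbar_mx a).

Definition true_cost (c : 'M[F]_(s + t, A)) (a : 'I_A) : 'cV[F]_t :=
  \col_i c (rshift s i) a.

Definition true_cost_policy (c : 'M[F]_(s + t, A)) : 'cV[F]_t :=
  \col_i c (rshift s i) (w (rshift s i)).

Definition fal_cost_policy (cfal : 'I_A -> 'cV[F]_s) : 'cV[F]_s :=
  \col_i cfal (w (lshift t i)) i 0.

End FalsifiedCosts.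

(* Main.v *)
Require Import Defs.
From mathcomp Require Import all_boot all_order all_algebra.

Set Implicit Arguments.
Unset Strict Implicit.
Unset Printing Implicit Defensive.

Import Order.TTheory GRing.Theory Num.Theory.
Local Open Scope ring_scope.

(** Whatever [x] is, the adversary can impose [x] as the falsified cost along
    [w] and raise the remaining falsified costs above the right-hand side.  When
    [w i = a] the [i]th row of [(I - beta P_a)(I - beta P_w)^-1] is that of the
    identity, so equality is automatic.  Only the true costs of the actions
    [a != w i] constrain [x], through [M_a x + N_a c < c_a] on the kept rows;
    a large multiple of a solution of [H x < 0] satisfies all of these. *)

Lemma discounted_stochastic_unitmx (F : realFieldType) (n : nat)
    (Q : 'M[F]_n) (beta : F) :
    (forall i j, 0 <= Q i j) -> (forall i, \sum_j Q i j = 1) ->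
    0 <= beta -> beta < 1 ->
  1%:M - beta *: Q \in unitmx.
Proof.
move=> Q_ge0 Q_sum1 beta_ge0 beta_lt1.
(* [det0P] yields a row vector killed from the left; transposing first makes [v] a fixed point of
   [beta *: Q] acting on columns, where the row sums of [Q] apply. *)
rewrite unitmxE unitfE -det_tr; apply/det0P => -[v /rV0Pn[i0 vi0] v_ker].
have fixv i : v 0 i = beta * \sum_j Q i j * v 0 j.
  move/matrixP/(_ 0 i): v_ker; rewrite linearB linearZ /= trmx1 mulmxBr mulmx1.
  rewrite -scalemxAr !mxE => /eqP; rewrite subr_eq0 => /eqP ->.
  by congr (_ * _); apply: eq_bigr => j _; rewrite mxE mulrC.
(* Maximum principle: at an index [m] where [|v|] is maximal, |v_m| <= beta |v_m|. *)
have [m _ m_max] := @arg_maxP _ _ _ i0 xpredT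
  (fun i => `|v 0 i|) isT.
have vm_gt0 : 0 < `|v 0 m| by rewrite (lt_le_trans _ (m_max i0 isT)) ?normr_gt0.
suff: `|v 0 m| <= beta * `|v 0 m| by rewrite leNgt gtr_pMl // beta_lt1.
rewrite {1}fixv normrM ger0_norm // ler_wpM2l //.
rewrite -[leRHS]mul1r -(Q_sum1 m) mulr_suml (le_trans (ler_norm_sum _ _ _)) //.
by apply: ler_sum => j _; rewrite normrM ger0_norm // ler_wpM2l //; apply: m_max.
Qed.

Lemma exists_scale_lt (F : realFieldType) (I : finType) (P : pred I)
    (u v : I -> F) :
  (forall i, P i -> u i < 0) -> exists L, forall i, P i -> L * u i < v i.
Proof.
(* Dividing by [u i < 0] turns the goal into [v i / u i < L]. The sum dominates each ratio, and the
   added 1 makes the bound strict. *)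
move=> u_lt0; exists (1 + \sum_i `|v i / u i|) => i Pi.
rewrite -ltr_ndivrMr ?u_lt0 // (le_lt_trans (ler_norm _)) //.
by rewrite (bigD1 i) //= addrCA ltrDl ltr_wpDr ?sumr_ge0 ?ltr01.
Qed.

Section FalsifiedRows.

Variables (F : realFieldType) (s t A : nat).
Variables (p : 'I_(s + t) -> 'I_(s + t) -> 'I_A -> F) (beta : F).
Variable w : 'I_(s + t) -> 'I_A.

(** Row [i] of [P_(w i)] is row [i] of [P_w], so the product has the same row [i] as a matrix times
    its own inverse. *)
Lemma value_mx_policy_row (i : 'I_(s + t)) :
    1%:M - beta *: policy_mx p w \in unitmx ->
  row i (value_mx p beta w (w i)) = row i 1%:M.
Proof.
move=> /mulmxV <-; rewrite !row_mul; congr (_ *m _).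
by apply/rowP => j; rewrite !mxE.
Qed.

Lemma H_mx_lt0_kept (x : 'cV[F]_s) (a : 'I_A) (i : 'I_t) :
    (forall k, (H_mx p beta w *m x) k 0 < 0) -> w (rshift s i) != a ->
  (M_mx p beta w a *m x) i 0 < 0.
Proof.
move=> Hx wi; have ia : i \in kept_rows w a by rewrite inE.
(* [k] is the position, in the stacked blocks, of the row of [Mbar_mx a] that comes from state
   [i]. *)
pose k := @tagnat.Rank _ (fun b => #|kept_rows w b|) a (enum_rank_in ia i).
have := Hx (cast_ord (sum_kept_rows w) k).
congr (_ < 0); rewrite !mxE; apply: eq_bigr => j _; congr (_ * _).
rewrite castmxE cast_ordK cast_ord_id.
have /matrixP/(_ (enum_rank_in ia i) j) := mxcolK (Mbar_mx p beta w) a.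
by rewrite mxE => ->; rewrite mxE enum_rankK_in.
Qed.

End FalsifiedRows.

Theorem theorem3 (F : realFieldType) (s t A : nat)
    (p : 'I_(s + t) -> 'I_(s + t) -> 'I_A -> F) (beta : F)
    (w : 'I_(s + t) -> 'I_A)
    (p_ge0 : forall i j a, 0 <= p i j a)
    (p_sum1 : forall i a, \sum_j p i j a = 1)
    (beta_gt0 : 0 < beta) (beta_lt1 : beta < 1)
    (hH : exists x : 'cV[F]_s, forall k, (H_mx p beta w *m x) k 0 < 0) :
  forall c : 'M[F]_(s + t, A),
  exists cfal : 'I_A -> 'cV[F]_s,
  forall a : 'I_A,
    let lhs := col_mx (cfal a) (true_cost c a) in
    let rhs := block_mx (R_mx p beta w a) (Y_mx p beta w a)
                        (M_mx p beta w a) (N_mx p beta w a)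
               *m col_mx (fal_cost_policy w cfal) (true_cost_policy w c) in
    forall i : 'I_(s + t),
      rhs i 0 <= lhs i 0 /\ (w i != a -> rhs i 0 < lhs i 0).
Proof.
case: hH => x Hx c.
have unitP : 1%:M - beta *: policy_mx p w \in unitmx.
  by apply: discounted_stochastic_unitmx (ltW beta_gt0) beta_lt1 => i *;
    rewrite ?mxE // -[RHS](p_sum1 i (w i)); apply: eq_bigr => j _; rewrite mxE.
(* Indexing by pairs (action, state) gives a single [L] that serves all actions at once. *)
have [L ltL] := @exists_scale_lt F _ (fun k => w (rshift s k.2) != k.1)
  (fun k => (M_mx p beta w k.1 *m x) k.2 0)
  (fun k => c (rshift s k.2) k.1 -
            (N_mx p beta w k.1 *m true_cost_policy w c) k.2 0)
  (fun k => H_mx_lt0_kept Hx).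
pose cost := col_mx (L *: x) (true_cost_policy w c).
(* There is no circularity: the right-hand side sees [cfal] only through its entries along [w],
   which are those of [L *: x], so the other entries can be set 1 above it. *)
pose cfal a : 'cV[F]_s := \col_i
  if w (lshift t i) == a then L * x i 0
  else (value_mx p beta w a *m cost) (lshift t i) 0 + 1.
exists cfal => a; have -> : fal_cost_policy w cfal = L *: x.
  by apply/colP => i; rewrite !mxE eqxx.
rewrite /= -/cost submxK => i; case: (eqVneq (w i) a) => [wi | wi_neq].
  split=> //; suff -> : (value_mx p beta w a *m cost) i 0 =
                     col_mx (cfal a) (true_cost c a) i 0 by [].
  transitivity (cost i 0).
    rewrite -wi.
    have := congr1 (fun r => (r *m cost) 0 0) (value_mx_policy_row i unitP).
    by rewrite -!row_mul mul1mx mxE [RHS]mxE.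
  case: (split_ordP i) wi => j ->; rewrite /cost ?col_mxEu ?col_mxEd !mxE.
    by move=> ->; rewrite eqxx.
  by move=> ->.
suff lt_i : (value_mx p beta w a *m cost) i 0 <
            col_mx (cfal a) (true_cost c a) i 0 by split=> //; apply: ltW.
case: (split_ordP i) wi_neq => j -> wj_neq.
  by rewrite col_mxEu [ltRHS]mxE (negPf wj_neq) ltrDl ltr01.
rewrite col_mxEd -[value_mx _ _ _ _]submxK mul_block_col col_mxEd [ltRHS]mxE.
rewrite -scalemxAr 2!mxE -ltrBrDr.
exact: (ltL (a, j)).
Qed.
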